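(* For all $b,\lambda\in\mathbb{C}^*$, the automorphism $L_bN^{\lambda}$ of $\mathbb{C}[X,Y,Z]$ is not linearizable.
   Context: Automorphisms of $\mathbb{C}[X,Y,Z]$ are $\mathbb{C}$-algebra automorphisms, written as the triple of images of $X,Y,Z$; products are compositions of maps on $\mathbb{C}[X,Y,Z]$, i.e. $(\varphi\psi)(p)=\varphi(\psi(p))$. The group of these is $\mathrm{GA}_3(\mathbb{C})$, and $\mathrm{GL}_3(\mathbb{C})\subset\mathrm{GA}_3(\mathbb{C})$ is the subgroup of linear automorphisms (each variable is sent to a linear form). $F\in\mathrm{GA}_3(\mathbb{C})$ is linearizable if there exist $G\in\mathrm{GA}_3(\mathbb{C})$ and $L'\in\mathrm{GL}_3(\mathbb{C})$ with $G^{-1}FG=L'$. Put $\Delta=XZ+Y^2$ and $\delta=-2Y\partial_X+Z\partial_Y$. For $\lambda\in\mathbb{C}$, $$N^{\lambda}=\exp(\lambda\Delta\delta)=(X-2\lambda Y\Delta-\lambda^2Z\Delta^2,\ Y+\lambda Z\Delta,\ Z).$$ For $b\in\mathbb{C}^*$, $L_b=(b^3X,bY,b^{-1}Z)$. *)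

(* Defs.v *)
From HB Require Import structures.
From mathcomp Require Import all_boot all_order all_algebra.
From mathcomp Require Import reals complex mpoly.
From mathcomp Require Import ring.

Set Implicit Arguments.
Unset Strict Implicit.
Unset Printing Implicit Defensive.

Import Order.TTheory GRing.Theory Num.Theory.
Local Open Scope ring_scope.

Section Automorphisms.
Variables (n : nat) (K : comNzRingType).

Record mpoly_aut := MpolyAut {
  aut_fun :> {lrmorphism {mpoly K[n]} -> {mpoly K[n]}};
  aut_inv : {lrmorphism {mpoly K[n]} -> {mpoly K[n]}};
  aut_funK : cancel aut_fun aut_inv;
  aut_invK : cancel aut_inv aut_fun }.

Definition autV (F : mpoly_aut) : mpoly_aut :=
  MpolyAut (aut_invK F) (aut_funK F).

(* The product is composition of maps on the polynomial ring (and not of the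
   associated polynomial maps of affine space): (F G)(p) = F (G p). *)
Definition autM (F G : mpoly_aut) : mpoly_aut :=
  @MpolyAut (F \o G) (aut_inv G \o aut_inv F)
    (can_comp (aut_funK F) (aut_funK G)) (can_comp (aut_invK G) (aut_invK F)).

Definition aut_linear (F : mpoly_aut) : Prop :=
  forall i : 'I_n, F 'X_i \is 1.-homog.

Definition linearizable (F : mpoly_aut) : Prop :=
  exists G L : mpoly_aut, aut_linear L /\ autM (autV G) (autM F G) =1 L.

Lemma comp_mpolyK (s t : n.-tuple {mpoly K[n]}) :
  (forall i, tnth s i \mPo t = 'X_i) -> cancel (comp_mpoly s) (comp_mpoly t).
Proof.
move=> st p; elim/mpolyind: p => [|c m p _ _ ih]; first by rewrite !raddf0.
rewrite !raddfD /= ih !comp_mpolyZ; congr (_ *: _ + _).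
rewrite comp_mpolyX rmorph_prod /= [RHS]mpolyXE_id.
by apply: eq_bigr => i _; rewrite rmorphXn /= st.
Qed.

(* The automorphism sending 'X_i to the i-th entry of s, with inverse given in
   the same way by t. *)
Definition aut_of_tuple (s t : n.-tuple {mpoly K[n]})
    (st : forall i, tnth s i \mPo t = 'X_i)
    (ts : forall i, tnth t i \mPo s = 'X_i) : mpoly_aut :=
  @MpolyAut (comp_mpoly s) (comp_mpoly t) (comp_mpolyK st) (comp_mpolyK ts).

End Automorphisms.

Section Nagata.
Variable K : fieldType.

Local Notation X := ('X_(0 : 'I_3) : {mpoly K[3]}).
Local Notation Y := ('X_(1 : 'I_3) : {mpoly K[3]}).
Local Notation Z := ('X_(2 : 'I_3) : {mpoly K[3]}).

Definition Delta : {mpoly K[3]} := X * Z + Y ^+ 2.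

Definition delta (p : {mpoly K[3]}) : {mpoly K[3]} :=
  - 2 * Y * p^`M(0) + Z * p^`M(1).

Definition nagata_tuple (l : K) : 3.-tuple {mpoly K[3]} :=
  [tuple X - (2 * l) *: (Y * Delta) - l ^+ 2 *: (Z * Delta ^+ 2);
         Y + l *: (Z * Delta);
         Z].

Definition diag_tuple (b : K) : 3.-tuple {mpoly K[3]} :=
  [tuple b ^+ 3 *: X; b *: Y; b^-1 *: Z].

Lemma comp_triple (a b c : {mpoly K[3]}) :
  (X \mPo [tuple a; b; c] = a) * (Y \mPo [tuple a; b; c] = b)
  * (Z \mPo [tuple a; b; c] = c).
Proof. by rewrite !comp_mpolyXU. Qed.

Lemma ord3P (P : 'I_3 -> Prop) : P 0 -> P 1 -> P 2 -> forall i, P i.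
Proof.
move=> P0 P1 P2 [[|[|[|//]]] hi].
- by have -> : Ordinal hi = 0 by exact/val_inj.
- by have -> : Ordinal hi = 1 by exact/val_inj.
- by have -> : Ordinal hi = 2 by exact/val_inj.
Qed.

Lemma nagata_tupleK (l : K) i :
  tnth (nagata_tuple l) i \mPo nagata_tuple (- l) = 'X_i.
Proof.
by elim/ord3P: i; rewrite !(tnth_nth 0) /nagata_tuple /Delta /=
  ?(rmorphB, rmorphD, linearZ, rmorphM, rmorphXn) /=
  ?linearZ /= ?(rmorphM, rmorphD, rmorphXn) /= ?comp_triple
  -?mul_mpolyC ?(rmorphM, rmorphN, rmorphXn, rmorph_nat) /=; ring.
Qed.

Lemma nagata_tupleVK (l : K) i :
  tnth (nagata_tuple (- l)) i \mPo nagata_tuple l = 'X_i.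
Proof. by have := nagata_tupleK (- l) i; rewrite opprK. Qed.

Lemma mderivXU (i j : 'I_3) :
  ('X_j : {mpoly K[3]})^`M(i) = (j == i)%:R.
Proof.
rewrite mderivX mnm1E; case: eqP => [->|_]; last by rewrite scale0r.
by rewrite -{1}[U_(_)%MM]add0m addmK mpolyX0 scale1r.
Qed.

Lemma deltaD p q : delta (p + q) = delta p + delta q.
Proof. by rewrite /delta !mderivD; ring. Qed.

Lemma deltaM p q : delta (p * q) = delta p * q + p * delta q.
Proof. by rewrite /delta !mderivM; ring. Qed.

Lemma deltaXE : (delta X = - 2 * Y) * (delta Y = Z) * (delta Z = 0).
Proof.
by do !split; rewrite /delta !mderivXU /=
  ?(mulr0n, mulr1n, mulr0, mulr1, addr0, add0r).
Qed.

Lemma delta_Delta : delta Delta = 0.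
Proof. by rewrite /Delta expr2 deltaD !deltaM !deltaXE; ring. Qed.

Lemma deltaN2 p : delta (- 2 * p) = - 2 * delta p.
Proof.
rewrite !mulNr !mulr_natl /delta !mderivN !mderivMn; ring.
Qed.

(* The triple nagata_tuple l lists the images of the variables under the
   exponential of the locally nilpotent derivation l * Delta * delta. *)
Lemma nagata_tuple_exp (l : K) (i : 'I_3) (D := fun p => Delta * delta p) :
  2%:R != 0 :> K ->
  iter 3 D 'X_i = 0 /\
  tnth (nagata_tuple l) i = \sum_(k < 3) (l ^+ k / k`!%:R) *: iter k D 'X_i.
Proof.
move=> K2.
have DX : D X = - 2 * (Delta * Y) by rewrite /D !deltaXE; ring.
have DY : D Y = Delta * Z by rewrite /D !deltaXE; ring.
have DZ : D Z = 0 by rewrite /D !deltaXE mulr0.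
have D0 : D 0 = 0 by rewrite /D /delta !mderiv0 !mulr0 addr0 mulr0.
have DDY : D (Delta * Z) = 0.
  by rewrite /D deltaM delta_Delta !deltaXE; ring.
have DDX : D (- 2 * (Delta * Y)) = - 2 * (Delta ^+ 2 * Z).
  by rewrite /D deltaN2 deltaM delta_Delta !deltaXE; ring.
have DDDX : D (- 2 * (Delta ^+ 2 * Z)) = 0.
  by rewrite /D deltaN2 expr2 !deltaM delta_Delta !deltaXE; ring.
have half : l ^+ 2 / 2 * 2 = l ^+ 2 by rewrite divfK.
elim/ord3P: i; rewrite !(tnth_nth 0) !big_ord_recl big_ord0 /=
  ?(DX, DY, DZ, DDX, DDDX, DDY, D0); split=> //; rewrite ?scaler0 ?addr0
  !expr0 divr1 scale1r ?expr1 ?divr1 //.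
- rewrite -[in LHS]half -!mul_mpolyC !rmorphM /= !rmorph_nat.
  by rewrite /bump /=; ring.
- by rewrite mulrC.
Qed.

Lemma diag_tupleK (b : K) (hb : b != 0) i :
  tnth (diag_tuple b) i \mPo diag_tuple b^-1 = 'X_i.
Proof.
elim/ord3P: i; rewrite (tnth_nth 0) /= comp_mpolyZ comp_triple scalerA.
- by rewrite -exprMn mulfV // expr1n scale1r.
- by rewrite mulfV // scale1r.
- by rewrite mulfV ?invr_neq0 // scale1r.
Qed.

Lemma diag_tupleVK (b : K) (hb : b != 0) i :
  tnth (diag_tuple b^-1) i \mPo diag_tuple b = 'X_i.
Proof.
by have := diag_tupleK (invr_neq0 hb) i; rewrite invrK.
Qed.

Definition nagata (l : K) : mpoly_aut 3 K :=
  aut_of_tuple (nagata_tupleK l) (nagata_tupleVK l).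

Definition diag_aut (b : K) (hb : b != 0) : mpoly_aut 3 K :=
  aut_of_tuple (diag_tupleK hb) (diag_tupleVK hb).

End Nagata.

(* Main.v *)
Require Import Defs.
From mathcomp Require Import all_boot all_order all_algebra.
From mathcomp Require Import reals complex mpoly.
From mathcomp Require Import ring.
Import GRing.Theory.
Local Open Scope ring_scope.

(** Write A for the polynomial ring, L for the diagonal automorphism, N for the
    Nagata-type automorphism and F = L N.  The weights (3, 1, -1) of L make it
    commute with N.  As L is diagonal on monomials and N - 1 is
    locally nilpotent, F = L N is a Jordan decomposition: every generalized
    eigenvector of F is an eigenvector of L with the same eigenvalue
    (diag_nagata_geigen).  On the other hand N displaces polynomials only inside
    a small ideal: (N - 1)(A) lies in Delta (Y, Z) (nagataB_in_Delta_YZ).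

    Suppose that G conjugates F to a linear automorphism L', and let M be the
    matrix of L' on linear forms.  Let v be a linear form that is a generalized
    eigenvector of L' for the eigenvalue mu.  Then p = G v is a generalized
    eigenvector of F, so L p = mu p and
      mu (N - 1) p = (F - mu) p = G ((L' - mu) v).
    This is the image under G of a linear form, and it lies in Delta (Y, Z).
    Since a nonzero linear form is irreducible, so is its image under G, whereas
    an element of Delta (Y, Z) is a product of two non-units; hence the element
    vanishes (in_Delta_YZ_lin_form) and N p = p.  Over an algebraically closed
    field such v span all linear forms (geigenspace_span), so N fixes G X, G Y
    and G Z, which generate A.  Thus N = 1, which is false for l <> 0.

    The argument amounts to transporting the conjugation from F to its unipotent
    part N and comparing ideals of fixed loci: that of N is Delta (Y, Z), while
    that of a linear map is generated by linear forms. *)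

(** * Locally nilpotent maps *)

Section LocallyNilpotent.
Set Implicit Arguments.
Unset Strict Implicit.

Lemma iter_raddf0 (V : zmodType) (f : {additive V -> V}) k : iter k f 0 = 0.
Proof. by elim: k => //= k ->; rewrite raddf0. Qed.

Lemma iter_raddfD (V : zmodType) (f : {additive V -> V}) k x y :
  iter k f (x + y) = iter k f x + iter k f y.
Proof. by elim: k => //= k ->; rewrite raddfD. Qed.

Lemma iter_raddf_leq (V : zmodType) (f : {additive V -> V}) i k x :
  (i <= k)%N -> iter i f x = 0 -> iter k f x = 0.
Proof. by move=> /subnK <- fx; rewrite iterD fx iter_raddf0. Qed.

Lemma iter_comm (T : Type) (f g : T -> T) k x :
  (forall y, f (g y) = g (f y)) -> iter k f (g x) = g (iter k f x).
Proof. by move=> fg; elim: k => //= k ->. Qed.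

(** One application of f + g to x gives f x, with a smaller exponent for f, plus
    g x, with a smaller exponent for g; commutation keeps the other exponent. *)
Lemma iter_addf_eq0 (V : zmodType) (f g : {additive V -> V}) i j x :
  (forall y, f (g y) = g (f y)) ->
  iter i f x = 0 -> iter j g x = 0 -> iter (i + j) (f \+ g) x = 0.
Proof.
move=> fg; have [n] := ubnP (i + j); elim: n => // n IH in i j x *.
case: i => [|i]; first by move=> _ x0 _; rewrite (x0 : x = 0) iter_raddf0.
case: j => [|j]; first by move=> _ _ x0; rewrite (x0 : x = 0) iter_raddf0.
rewrite ltnS => lt_n fx gx; rewrite addSn iterSr iter_raddfD.
have -> : iter (i + j.+1) (f \+ g) (f x) = 0.
  by apply: IH => //; [rewrite -iterSr | rewrite iter_comm ?gx ?raddf0].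
rewrite add0r -addSnnS; apply: IH => //; first by rewrite addSnnS.
  by rewrite iter_comm // fx raddf0.
by rewrite -iterSr.
Qed.

(** A unipotent commuting factor g does not change generalized eigenvectors:
    f - mu is the sum of the commuting maps f g - mu and - f (g - 1), which are
    both nilpotent on x. *)
Lemma iter_comp_unipotent (K : pzRingType) (V : lmodType K)
    (f g : {linear V -> V}) mu i j x : (forall y, f (g y) = g (f y)) ->
  iter i ((f \o g) \- mu \*: idfun) x = 0 -> iter j (g \- idfun) x = 0 ->
  iter (i + j) (f \- mu \*: idfun) x = 0.
Proof.
move=> fgE fx gx.
pose h : {additive V -> V} := f \- (f \o g).
pose s : {additive V -> V} := (f \o g) \- mu \*: idfun.
have -> : iter (i + j) (f \- mu \*: idfun) x = iter (i + j) (s \+ h) x.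
  by apply: eq_iter => y /=; rewrite [RHS]addrC addrA subrK.
apply: iter_addf_eq0 => // [y|] /=.
  have fZ u : f (mu *: u) = mu *: f u by exact: linearZ.
  have gZ u : g (mu *: u) = mu *: g u by exact: linearZ.
  by rewrite !raddfB /= -!fgE !opprK gZ !fZ addrACA.
elim: j x gx {i fx} => [|j IH] // x gx; rewrite iterSr; apply: IH.
rewrite iter_comm => [|y]; last first.
  by rewrite /= !raddfB /= -!fgE !opprK addrACA.
by move/subr0_eq: gx => /= gu; rewrite -raddfB /= gu subrr raddf0.
Qed.

(** With a = phi - 1 one has a (p q) = a p a q + a p q + p a q, where each term
    has a smaller total exponent of nilpotency.  So the polynomials on which
    phi - 1 is nilpotent form a subalgebra, and local nilpotency needs to be
    checked on generators only. *)
Lemma iter_rmorphB_mul (A : comNzRingType) (phi : {rmorphism A -> A})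
    (a := phi \- idfun) i j p q :
  iter i a p = 0 -> iter j a q = 0 -> iter (i + j) a (p * q) = 0.
Proof.
have [n] := ubnP (i + j); elim: n => // n IH in i j p q *.
case: i => [|i].
  by move=> _ p0; rewrite (p0 : p = 0) mul0r iter_raddf0.
case: j => [|j].
  by move=> _ _ q0; rewrite (q0 : q = 0) mulr0 iter_raddf0.
rewrite ltnS => lt_n ap aq; rewrite addSn iterSr.
have -> : a (p * q) = a p * a q + (a p * q + p * a q).
  by rewrite /a /= rmorphM; ring.
have ap' : iter i a (a p) = 0 by rewrite -iterSr.
have aq' : iter j a (a q) = 0 by rewrite -iterSr.
rewrite !iter_raddfD (IH i j.+1 (a p) q) // (IH i j.+1 (a p) (a q)) //.
  by rewrite -addSnnS (IH i.+1 j p (a q)) ?addr0 // addSnnS.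
exact: iter_raddf_leq (leqnSn j) aq'.
Qed.

End LocallyNilpotent.

(** * Generalized eigenspaces *)

(** The characteristic polynomial splits and divides the product of the coprime
    polynomials ('X - z) ^+ n.+1 over its distinct roots z, so that product
    kills M by Cayley-Hamilton and its kernel is the sum of theirs. *)
Lemma geigenspace_span (K : closedFieldType) (n : nat) (M : 'M[K]_n.+1) :
  exists rs : seq K,
    (1%:M <= \sum_(i < size rs) geigenspace M (nth 0%R rs i))%MS.
Proof.
have [r] := closed_field_poly_normal (char_poly M).
rewrite (monicP (char_poly_monic M)) scale1r => Dchi.
exists (undup r); set rs := undup r.
rewrite -(kermxpoly_prod M); last first.
  move=> i j _ _ ji; rewrite coprimep_expl // coprimep_expr //.
  rewrite coprimep_XsubC root_XsubC nth_uniq ?undup_uniq //.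
rewrite /kermxpoly; suff -> : horner_mx M
    (\prod_(i < size rs) ('X - (nth 0%R rs i)%:P) ^+ n.+1) = 0.
  by apply/sub_kermxP; rewrite mulmx0.
have /dvdpP[q ->] :
    char_poly M %| \prod_(i < size rs) ('X - (nth 0%R rs i)%:P) ^+ n.+1.
  (* The multiplicity of a root is at most the degree n.+1. *)
  rewrite Dchi -big_undup_iterop_count -/rs.
  rewrite -[X in _ %| X](big_mkord xpredT (fun i =>
    ('X - (nth 0%R rs i)%:P) ^+ n.+1)) -(big_nth _ xpredT
    (fun z => ('X - z%:P) ^+ n.+1)).
  have size_r : size r = n.+1.
    by apply/eq_add_S; rewrite -(size_char_poly M) Dchi size_prod_XsubC.
  elim: rs => [|z s IHs]; first by rewrite !big_nil dvdpp.
  rewrite !big_cons dvdp_mul // Monoid.iteropE -size_r.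
  by rewrite iter_mulr_1 dvdp_exp2l // count_size.
by rewrite rmorphM /= Cayley_Hamilton mulr0.
Qed.

(** * Polynomials *)

Section Polynomials.
Set Implicit Arguments.
Unset Strict Implicit.

Variables (n : nat) (K : fieldType).
Implicit Types (p q : {mpoly K[n]}) (v : 'rV[K]_n).

Lemma mpoly_alg_ind (P : {mpoly K[n]} -> Prop) :
  (forall c, P c%:MP) -> (forall i, P 'X_i) ->
  (forall p q, P p -> P q -> P (p + q)) ->
  (forall p q, P p -> P q -> P (p * q)) -> forall p, P p.
Proof.
move=> PC PX PD PM; elim/mpolyind => [|c m p _ _ Pp]; first exact: (PC 0).
apply: PD => //; rewrite -mul_mpolyC; apply: (PM) => //; rewrite mpolyXE_id.
apply: big_ind => [||i _]; [exact: (PC 1) | exact: PM |].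
by elim: (m i) => [|k IH]; rewrite ?expr0 ?exprS; [exact: (PC 1)|exact: PM].
Qed.

Lemma lrmorphC (f : {lrmorphism {mpoly K[n]} -> {mpoly K[n]}}) c :
  f c%:MP = c%:MP.
Proof. by rewrite -[c]mulr1 mpolyCM mul_mpolyC linearZ rmorph1. Qed.

Lemma lrmorph_eqX (f g : {lrmorphism {mpoly K[n]} -> {mpoly K[n]}}) :
  (forall i, f 'X_i = g 'X_i) -> f =1 g.
Proof.
move=> fg; apply: mpoly_alg_ind => [c||p q fp fq|p q fp fq] //.
- by rewrite !lrmorphC.
- by rewrite !rmorphD /= fp fq.
- by rewrite !rmorphM /= fp fq.
Qed.

Definition lin_form v : {mpoly K[n]} := \sum_i v 0 i *: 'X_i.

Lemma mcoeff_lin_form v i : (lin_form v)@_U_(i) = v 0 i.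
Proof.
rewrite /lin_form raddf_sum (bigD1 i) //= mcoeffZ mcoeffXU eqxx mulr1.
by rewrite big1 ?addr0 // => j /negPf ji; rewrite mcoeffZ mcoeffXU ji mulr0.
Qed.

Lemma lin_form_homog v : lin_form v \is 1.-homog.
Proof. by apply: rpred_sum => i _; rewrite rpredZ // dhomogX /= mdeg1. Qed.

Lemma lin_formP p : p \is 1.-homog -> p = lin_form (\row_i p@_U_(i)).
Proof.
move=> ph; apply/mpolyP => m; have [m1|m1] := eqVneq (mdeg m) 1%N.
  have /mdeg1P[i /eqP ->] : mdeg m == 1%N by rewrite m1.
  by rewrite mcoeff_lin_form mxE.
by rewrite !(dhomog_nemf_coeff _ m1) ?lin_form_homog.
Qed.

Lemma lin_formD u v : lin_form (u + v) = lin_form u + lin_form v.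
Proof.
rewrite /lin_form -big_split; apply: eq_bigr => i _ /=.
by rewrite mxE scalerDl.
Qed.

Lemma lin_formZ c v : lin_form (c *: v) = c *: lin_form v.
Proof.
rewrite /lin_form scaler_sumr; apply: eq_bigr => i _ /=.
by rewrite mxE scalerA.
Qed.

Lemma lin_formB u v : lin_form (u - v) = lin_form u - lin_form v.
Proof. by rewrite -scaleN1r lin_formD lin_formZ scaleN1r. Qed.

Lemma lin_form0 : lin_form 0 = 0.
Proof. by rewrite -[0](subrr 0) lin_formB subrr. Qed.

Lemma lin_form_sum (I : finType) (v : I -> 'rV[K]_n) :
  lin_form (\sum_i v i) = \sum_i lin_form (v i).
Proof. exact: (big_morph _ lin_formD lin_form0). Qed.

Lemma lin_form_delta i : lin_form (delta_mx 0 i) = 'X_i.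
Proof.
rewrite /lin_form (bigD1 i) //= mxE !eqxx scale1r big1 ?addr0 // => j ji.
by rewrite mxE (negPf ji) andbF scale0r.
Qed.

Lemma aut_linear_mulmx (L : mpoly_aut n K) : aut_linear L ->
  exists M : 'M[K]_n, forall v, L (lin_form v) = lin_form (v *m M).
Proof.
move=> Llin; exists (\matrix_i \row_j (L 'X_i)@_U_(j)) => v.
rewrite mulmx_sum_row lin_form_sum {1}/lin_form raddf_sum.
by apply: eq_bigr => i _ /=; rewrite linearZ lin_formZ rowK -lin_formP.
Qed.

(** Degrees add up over a domain, so linear forms are irreducible. *)
Lemma dhomog1_mul_const p q : p * q \is 1.-homog -> p * q != 0 ->
  (exists c, p = c%:MP) \/ (exists c, q = c%:MP).
Proof.
move=> pqh nz; have /norP[nzp nzq] : ~~ ((p == 0) || (q == 0)).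
  by rewrite -mulf_eq0.
have sz : msize (p * q) = 2%N.
  apply/eqP; rewrite -(prednK (n := msize (p * q))) ?lt0n ?msize_poly_eq0 //.
  by rewrite eqSS; apply/eqP; apply: dhomog_uniq nz (dhomog_msize pqh) pqh.
have := msizeM nzp nzq; rewrite sz.
have [sp _|sp] := leqP (msize p) 1.
  by left; exists p@_0; apply: msize1_polyC.
have [sq _|sq] := leqP (msize q) 1.
  by right; exists q@_0; apply: msize1_polyC.
by case: (msize p) sp => [|[|k]] // _; case: (msize q) sq => [|[|j]] // _;
  rewrite !addnS.
Qed.

End Polynomials.

(** * The automorphism *)

Section Nagata.
Set Implicit Arguments.
Unset Strict Implicit.

Variable K : fieldType.
Implicit Types (p q : {mpoly K[3]}).

Local Notation X := ('X_(0 : 'I_3) : {mpoly K[3]}).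
Local Notation Y := ('X_(1 : 'I_3) : {mpoly K[3]}).
Local Notation Z := ('X_(2 : 'I_3) : {mpoly K[3]}).
Local Notation Delta := (Delta K).

Variables (b : K) (hb : b != 0) (l : K).
Local Notation L := (diag_aut hb).
Local Notation N := (nagata l).

Lemma nagataX :
  (N X = X - (2 * l)%:MP * (Y * Delta) - (l ^+ 2)%:MP * (Z * Delta ^+ 2))
  * (N Y = Y + l%:MP * (Z * Delta)) * (N Z = Z).
Proof. by rewrite /nagata /= !comp_triple -!mul_mpolyC. Qed.

Lemma diagX : (L X = b ^+ 3 *: X) * (L Y = b *: Y) * (L Z = b^-1 *: Z).
Proof. by rewrite /diag_aut /= !comp_triple. Qed.

Lemma diag_monomial m : exists c, forall p, (L p)@_m = c * p@_m.
Proof.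
pose e (m : 'X_{1.. 3}) := \prod_(i < 3) (nth 0 [:: b ^+ 3; b; b^-1] i) ^+ m i.
have LX m' : L 'X_[m'] = e m' *: 'X_[m'].
  rewrite /diag_aut /= comp_mpolyX [in RHS]mpolyXE_id -mul_mpolyC.
  rewrite rmorph_prod /= -big_split; apply: eq_bigr => i _ /=.
  rewrite rmorphXn /= -exprMn mul_mpolyC; congr (_ ^+ _).
  by elim/ord3P: i; rewrite (tnth_nth 0).
exists (e m); elim/mpolyind => [|c m' p _ _ IH]; first by rewrite !raddf0 mulr0.
have -> : L (c *: 'X_[m'] + p) = c *: L 'X_[m'] + L p by exact: linearP.
rewrite !mcoeffD LX IH !mcoeffZ mcoeffX mulrDr.
by case: eqP => [->|_]; rewrite ?mulr1 ?mulr0 ?(mulrC c).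
Qed.

Lemma nagata_Delta : N Delta = Delta.
Proof.
rewrite /Defs.Delta rmorphD rmorphM rmorphXn /= !nagataX /Defs.Delta.
by rewrite rmorphM rmorph_nat rmorphXn /=; ring.
Qed.

(** Membership in Delta (Y, Z), the ideal that defines the fixed locus of N. *)
Definition in_Delta_YZ p := exists u v, p = Delta * (Y * u + Z * v).

(** The polynomials p with N p - p in an ideal form a subalgebra, because
    N (p q) - p q = (N p - p) N q + p (N q - q); so the variables suffice. *)
Lemma nagataB_in_Delta_YZ p : in_Delta_YZ (N p - p).
Proof.
elim/mpoly_alg_ind: p =>
  [c||p q [u [v Np]] [u' [v' Nq]]|p q [u [v Np]] [u' [v' Nq]]].
- by exists 0, 0; rewrite lrmorphC subrr; ring.
- elim/ord3P; rewrite nagataX.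
  + exists (- (2 * l)%:MP), (- (l ^+ 2)%:MP * Delta); ring.
  + exists 0, l%:MP; ring.
  + exists 0, 0; ring.
- exists (u + u'), (v + v'); rewrite rmorphD opprD addrACA Np Nq; ring.
- exists (u * N q + p * u'), (v * N q + p * v').
  have -> : N (p * q) - p * q = (N p - p) * N q + p * (N q - q).
    by rewrite rmorphM; ring.
  by rewrite Np Nq; ring.
Qed.

(** N fixes Z and Delta, it moves Y by a product of these, and X by products of
    these and Y; hence N - 1 is nilpotent on Z, then on Y, then on X. *)
Lemma nagata_unipotent p : exists k, iter k (N \- idfun) p = 0.
Proof.
pose nilp p := exists k, iter k (N \- idfun) p = 0; rewrite -/(nilp p).
have nilpD q r : nilp q -> nilp r -> nilp (q + r).
  move=> [i iq] [j jr]; exists (i + j)%N; rewrite iter_raddfD.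
  rewrite (iter_raddf_leq (leq_addr j i) iq).
  by rewrite (iter_raddf_leq (leq_addl i j) jr) addr0.
have nilpM q r : nilp q -> nilp r -> nilp (q * r).
  by move=> [i iq] [j jr]; exists (i + j)%N; apply: iter_rmorphB_mul.
have nilpS q : nilp (N q - q) -> nilp q.
  by move=> [k kq]; exists k.+1; rewrite iterSr.
have nilp_fix q : N q = q -> nilp q.
  by move=> Nq; exists 1%N; rewrite /= Nq subrr.
have nilpC c : nilp c%:MP by apply/nilp_fix/lrmorphC.
have nilpZ : nilp Z by apply/nilp_fix; rewrite nagataX.
have nilpDelta : nilp Delta by apply/nilp_fix/nagata_Delta.
have nilpY : nilp Y.
  apply/nilpS; rewrite nagataX addrAC subrr add0r.
  by apply: (nilpM) => //; apply: (nilpM).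
elim/mpoly_alg_ind: p => // i; elim/ord3P: i => //.
apply/nilpS; rewrite nagataX.
have -> : X - (2 * l)%:MP * (Y * Delta) - (l ^+ 2)%:MP * (Z * Delta ^+ 2) - X =
  (- (2 * l))%:MP * (Y * Delta) + (- l ^+ 2)%:MP * (Z * (Delta * Delta)).
  by rewrite !mpolyCN; ring.
by apply: (nilpD); apply: (nilpM) => //; apply: (nilpM) => //; apply: (nilpM).
Qed.

Lemma nagata_neq1 : l != 0 -> N Y != Y.
Proof.
move=> nzl; rewrite nagataX -subr_eq0 addrAC subrr add0r.
(* Z and Delta both take the value 1 at the point (1, 0, 1), whatever the
   characteristic. *)
pose v (i : 'I_3) : K := (i != 1)%:R.
have ZDv : (Z * Delta).@[v] = 1.
  by rewrite /Defs.Delta expr2 !(mevalM, mevalD, mevalXU) /v /=; ring.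
apply/eqP => /(congr1 (meval v)) /eqP.
by rewrite mevalM mevalC ZDv meval0 mulr1 (negPf nzl).
Qed.

(** L multiplies Delta by b ^+ 2, hence Y * Delta, Z * Delta ^+ 2 by b ^+ 3, as
    it does X, and Z * Delta by b, as it does Y. *)
Lemma diag_nagata_comm p : L (N p) = N (L p).
Proof.
(* Only the values of the two morphisms on the variables are used. *)
suff comm (f g : {lrmorphism {mpoly K[3]} -> {mpoly K[3]}}) :
    (f X = b ^+ 3 *: X) * (f Y = b *: Y) * (f Z = b^-1 *: Z) ->
    (g X = X - (2 * l)%:MP * (Y * Delta) - (l ^+ 2)%:MP * (Z * Delta ^+ 2))
    * (g Y = Y + l%:MP * (Z * Delta)) * (g Z = Z) -> f \o g =1 g \o f.
  exact: comm diagX nagataX p.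
move=> {p} fX gX.
have fD : f Delta = (b ^+ 2)%:MP * Delta.
  rewrite /Defs.Delta rmorphD rmorphM rmorphXn /= !fX.
  rewrite -scalerAl -scalerAr scalerA exprSr mulfK // exprZn -scalerDr.
  by rewrite mul_mpolyC.
have ZD : b^-1 *: Z * ((b ^+ 2)%:MP * Delta) = b *: (Z * Delta).
  by rewrite mul_mpolyC -scalerAr -scalerAl scalerA expr2 mulfK.
apply: (@lrmorph_eqX _ _ (f \o g) (g \o f)) => i.
elim/ord3P: i => /=; rewrite gX fX linearZ /= gX.
- rewrite !rmorphB !rmorphM /= !lrmorphC fD !fX.
  rewrite [in X in _ - X]expr2 [b^-1 *: Z * _]mulrA ZD.
  by rewrite -!mul_mpolyC !rmorphXn /=; ring.
- by rewrite rmorphD !rmorphM /= !lrmorphC fD !fX ZD -!mul_mpolyC; ring.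
- by [].
Qed.

(** A monomial of eigenvalue c is an eigenvector of (L - mu) ^ k for
    (c - mu) ^ k, so it can occur in p only if c = mu. *)
Lemma diag_semisimple mu k p :
  iter k (L \- mu \*: idfun) p = 0 -> L p = mu *: p.
Proof.
move=> Lp; apply/mpolyP => m; have [c cP] := diag_monomial m.
have : (c - mu) ^+ k * p@_m = 0.
  move/(congr1 (mcoeff m)): Lp; rewrite mcoeff0 => <-.
  elim: k => [|k IH]; first by rewrite mul1r.
  by rewrite /= mcoeffB mcoeffZ cP -IH exprS; ring.
move/eqP; rewrite mulf_eq0 expf_eq0 cP mcoeffZ => /orP[/andP[_]|/eqP ->].
  by rewrite subr_eq0 => /eqP ->.
by rewrite !mulr0.
Qed.

(** L is the semisimple part of L N. *)
Lemma diag_nagata_geigen mu k p :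
  iter k (autM L N \- mu \*: idfun) p = 0 -> L p = mu *: p.
Proof.
move=> Fp; have [j Np] := nagata_unipotent p.
apply: (@diag_semisimple mu (k + j)).
exact: (iter_comp_unipotent (f := L) (g := N) diag_nagata_comm Fp Np).
Qed.

End Nagata.

(** * Comparison with a linear automorphism *)

(** Apply the inverse of G to a factorization Delta * r with r in (Y, Z): a
    nonzero linear form would have a constant factor, so Delta or r would be
    constant.  Delta takes both values 0 and 1, and r vanishes at the origin, so
    that r would be 0. *)
Lemma in_Delta_YZ_lin_form (K : fieldType) (G : mpoly_aut 3 K) (v : 'rV[K]_3) :
  in_Delta_YZ (G (lin_form v)) -> G (lin_form v) = 0.
Proof.
move=> [p [q Gv]]; apply/eqP/negPn/negP => nz.
set r := _ + _ in Gv.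
have r0 : r.@[fun=> 0] = 0 by rewrite !(mevalD, mevalM, mevalXU); ring.
have Dv : aut_inv G (Delta K) * aut_inv G r = lin_form v.
  by rewrite -rmorphM -Gv; apply: aut_funK.
have const (f : {mpoly K[3]}) c : aut_inv G f = c%:MP -> f = c%:MP.
  by move=> fc; rewrite -[f](aut_invK G) fc lrmorphC.
have [|||] := @dhomog1_mul_const _ _ (aut_inv G (Delta K)) (aut_inv G r).
- by rewrite Dv lin_form_homog.
- by rewrite Dv; apply: contraNneq nz => ->; rewrite raddf0.
- move=> [c /const Dc].
  have D0 : (Delta K).@[fun=> 0] = 0.
    by rewrite /Delta expr2 !(mevalM, mevalD, mevalXU); ring.
  have D1 : (Delta K).@[fun i => (i == 1)%:R] = 1.
    by rewrite /Delta expr2 !(mevalM, mevalD, mevalXU) /=; ring.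
  by move: D1 D0; rewrite Dc !mevalC => -> /eqP; rewrite oner_eq0.
- move=> [c /const rc]; move: r0 Gv nz; rewrite rc mevalC => ->.
  by rewrite mpolyC0 mulr0 => ->; rewrite eqxx.
Qed.

Lemma not_linearizable_diag_nagata (K : closedFieldType) (b l : K)
    (hb : b != 0) : l != 0 -> ~ linearizable (autM (diag_aut hb) (nagata l)).
Proof.
move=> nzl [G [L' [/aut_linear_mulmx[M L'M] FG]]].
set N := nagata l; set L := diag_aut hb.
have FGv v : L (N (G (lin_form v))) = G (lin_form (v *m M)).
  by rewrite -L'M -FG; apply/esym/(aut_invK G).
(* mu (N - 1) p = (F - mu) p is the image of a linear form in Delta (Y, Z). *)
have fix_geigen mu v : (v <= geigenspace M mu)%MS ->
    N (G (lin_form v)) = G (lin_form v).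
  rewrite geigenspaceE => /sub_kermxP Mv.
  have Lv : L (G (lin_form v)) = mu *: G (lin_form v).
    apply: (@diag_nagata_geigen _ _ hb l mu 3).
    have iterF k : iter k (autM L N \- mu \*: idfun) (G (lin_form v)) =
        G (lin_form (v *m (M - mu%:M) ^+ k)).
      elim: k => [|k /= ->]; first by rewrite mulmx1.
      rewrite FGv -linearZ -lin_formZ -mul_mx_scalar -raddfB exprSr mulmxA.
      by rewrite mulmxBr -lin_formB.
    by rewrite iterF Mv lin_form0 raddf0.
  have FNv : L (N (G (lin_form v))) = mu *: N (G (lin_form v)).
    by rewrite diag_nagata_comm Lv; exact: linearZ.
  have muNv : mu *: (N (G (lin_form v)) - G (lin_form v)) =
      G (lin_form (v *m M - mu *: v)).
    by rewrite scalerBr -FNv FGv -[_ *: G _]linearZ -raddfB lin_formB lin_formZ.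
  have : in_Delta_YZ (G (lin_form (v *m M - mu *: v))).
    have [p [q Npq]] := nagataB_in_Delta_YZ l (G (lin_form v)).
    exists (mu%:MP * p), (mu%:MP * q).
    by rewrite -muNv Npq -mul_mpolyC; ring.
  move/in_Delta_YZ_lin_form; rewrite -muNv => /eqP; rewrite scaler_eq0.
  case/orP => [/eqP mu0|]; last by rewrite subr_eq0 => /eqP.
  (* For mu = 0, the polynomial itself is killed by the injective L. *)
  have -> : G (lin_form v) = 0.
    by apply: (can_inj (aut_funK L)); rewrite Lv mu0 scale0r raddf0.
  by rewrite raddf0.
have NG : N \o G =1 G.
  apply: (@lrmorph_eqX _ _ (N \o G) G) => i.
  change (N (G 'X_i) = G 'X_i); rewrite -lin_form_delta.
  have [rs span] := geigenspace_span M.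
  have /sub_sumsmxP[u ->] : ((delta_mx 0 i : 'rV[K]_3) <=
      \sum_(j < size rs) geigenspace M (nth 0%R rs j))%MS.
    by apply: submx_trans span; apply: submx1.
  rewrite lin_form_sum !raddf_sum; apply: eq_bigr => j _.
  by apply: (fix_geigen (nth 0%R rs j)); rewrite submxMl.
have /eqP[] := nagata_neq1 nzl.
by rewrite -['X_1](aut_invK G); apply: NG.
Qed.

Theorem corollary3p8 (R : realType) (b l : R[i]) (hb : b != 0) (hl : l != 0) :
  ~ linearizable (autM (diag_aut hb) (nagata l)).
Proof. exact: not_linearizable_diag_nagata. Qed.
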